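(* Let $m,L,R\ge1$ be integers, let $\lambda_1,\ldots,\lambda_R\ge0$ be mixing weights with $\sum_{r=1}^R\lambda_r=1$, and let $(p^{(r)},w^{(r)})_{r=1}^R$ be a kernel--boundary system. Suppose that the finite covering inequalities \[ \sum_{r=1}^R\left(\lambda_r\sum_{i=0}^{m-1}p_i^{(r)}w_{q+i}^{(r)}\right)\ge1 \qquad\text{for all integers } 0\le q\le Lm \] hold and that $b>0$, where \[ a:=m\sum_{r=1}^R\lambda_r\sum_{i=0}^{m-1}\left(p_i^{(r)}\right)^2, \qquad b:=1+2\left(\frac1m\sum_{r=1}^R\lambda_r\sum_{j=0}^{Lm-1}\left(w_j^{(r)}\right)^2-L\right). \] Then, for all sufficiently large $N$, \[ F(N)\le N^{1/2}+\sqrt{ab}\,N^{1/4}+O(1), \] that is, there are constants $C$ and $N_0$ (which may depend on the system and on $m,L,R,\lambda_1,\ldots,\lambda_R$, but not on $N$) such that $F(N)\le N^{1/2}+\sqrt{ab}\,N^{1/4}+C$ for all integers $N\ge N_0$.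
   Context: A finite set $A\subset\mathbb{Z}$ is called Sidon if whenever $a,b,c,d\in A$ satisfy $a-b=c-d\ne0$, then $(a,b)=(c,d)$. For a positive integer $N$, $F(N)$ denotes the largest cardinality of a Sidon subset of $\{0,1,\ldots,N-1\}$. A kernel vector (of length $m$) is a symmetric probability vector $p=(p_0,\ldots,p_{m-1})$ of real numbers: $p_i\ge0$, $\sum_{i=0}^{m-1}p_i=1$, and $p_i=p_{m-1-i}$ for $0\le i\le m-1$. A boundary vector is a vector $w=(w_0,\ldots,w_{Lm-1})$ of real numbers (of any sign), extended by the convention $w_j=1$ for every $j\ge Lm$. A kernel--boundary pair is a pair $(p,w)$ of a kernel vector and a boundary vector; a kernel--boundary system is a collection $(p^{(r)},w^{(r)})_{r=1}^R$ of kernel--boundary pairs, with $p^{(r)}=(p^{(r)}_0,\ldots,p^{(r)}_{m-1})$ and $w^{(r)}=(w^{(r)}_0,\ldots,w^{(r)}_{Lm-1})$, so that $w^{(r)}_j=1$ for $j\ge Lm$. *)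

(* Defs.v *)
From HB Require Import structures.
From mathcomp Require Import all_boot all_order all_algebra finmap.
From mathcomp Require Import boolp reals exp.

Set Implicit Arguments.
Unset Strict Implicit.
Unset Printing Implicit Defensive.

Import Order.TTheory GRing.Theory Num.Theory.

Local Open Scope ring_scope.

Definition sidon (A : {fset int}) : Prop :=
  forall a b c d : int, a \in A -> b \in A -> c \in A -> d \in A ->
    a - b = c - d -> a - b <> 0 -> (a, b) = (c, d).

Definition interval0 (N : nat) : {fset int} := [fset i%:Z | i in iota 0 N]%fset.

Definition sidon_max (N : nat) : nat :=
  \max_(A <- fpowerset (interval0 N) | `[< sidon A >]) #|` A|%fset.

(* [rev_ord i] is the index m - 1 - i. *)
Definition kernel_vector (R : realType) (m : nat) (p : 'rV[R]_m) : Prop :=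
  [/\ forall i, 0 <= p 0 i,
      \sum_(i < m) p 0 i = 1 &
      forall i, p 0 i = p 0 (rev_ord i)].

(* The entry w_j for arbitrary j, with the convention w_j = 1 for j >= n. *)
Definition boundary_entry (R : realType) (n : nat) (w : 'rV[R]_n) (j : nat) : R :=
  if insub j is Some k then w 0 k else 1.

Section System.
Variables (R : realType) (m L K : nat).
Variables (lam : 'I_K -> R) (p : 'I_K -> 'rV[R]_m) (w : 'I_K -> 'rV[R]_(L * m)).

Definition covering : Prop :=
  forall q : nat, (q <= L * m)%N ->
    1 <= \sum_(r < K) (lam r * \sum_(i < m) p r 0 i * boundary_entry (w r) (q + i)).

Definition kernel_energy : R :=
  m%:R * \sum_(r < K) (lam r * \sum_(i < m) (p r 0 i) ^+ 2).

Definition boundary_energy : R :=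
  1 + 2 * (m%:R^-1 * \sum_(r < K) (lam r * \sum_(j < L * m) (w r 0 j) ^+ 2) - L%:R).

End System.

Arguments boundary_energy {R} m L {K} lam w.

(* Main.v *)
Require Import Defs.
From HB Require Import structures.
From mathcomp Require Import all_boot all_order all_algebra finmap.
From mathcomp Require Import boolp reals exp.
From mathcomp Require Import zify ring lra.

Set Implicit Arguments.
Unset Strict Implicit.
Unset Printing Implicit Defensive.

Import Order.TTheory GRing.Theory Num.Theory.

Local Open Scope ring_scope.

(* Slide a window of m blocks of length h over the interval, weighting the
   offsets by p^(r) / h, and let S_r(t) be the weighted count of points of A in
   the window at t.  Weight the window positions by W_r(t), which reads w^(r)
   inwards from both ends of the range of t.  The covering inequalities give
   |A| <= sum_r lam_r sum_t W_r(t) S_r(t).  By Cauchy-Schwarz |A|^2 is at most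
   the product of the lam-averaged energies of W and S: with u = m h the first
   is N + u b, and the second is at most 1 + |A| a / u, because in a Sidon set
   every nonzero difference occurs at most once.  Choosing u close to
   sqrt (a / b) N^(3/4) gives the bound. *)

(** * Weighted Cauchy-Schwarz inequality *)

(** Lagrange's identity: twice the difference of the two sides is a sum of squares weighted by
    [mu i * mu j]. *)
Lemma weighted_cauchy_schwarz (R : realFieldType) (I : finType)
    (mu f g : I -> R) : (forall i, 0 <= mu i) ->
  (\sum_i mu i * (f i * g i)) ^+ 2
    <= (\sum_i mu i * f i ^+ 2) * (\sum_i mu i * g i ^+ 2).
Proof.
move=> mu_ge0.
have: 0 <= \sum_i \sum_j mu i * mu j * (f i * g j - f j * g i) ^+ 2.
  by apply: sumr_ge0 => i _; apply: sumr_ge0 => j _; rewrite mulr_ge0 ?sqr_ge0 ?mulr_ge0.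
suff -> : \sum_i \sum_j mu i * mu j * (f i * g j - f j * g i) ^+ 2 =
    2 * ((\sum_i mu i * f i ^+ 2) * (\sum_i mu i * g i ^+ 2)
         - (\sum_i mu i * (f i * g i)) ^+ 2).
  by move=> lagrange_ge0; lra.
pose c i j := mu i * f i ^+ 2 * (mu j * g j ^+ 2).
pose d i j := mu i * (f i * g i) * (mu j * (f j * g j)).
transitivity (\sum_i \sum_j (c i j + c j i - 2 * d i j)).
  by apply: eq_bigr => i _; apply: eq_bigr => j _; rewrite /c /d; ring.
have sumc : \sum_i \sum_j c i j =
    (\sum_i mu i * f i ^+ 2) * (\sum_i mu i * g i ^+ 2).
  by rewrite mulr_suml; apply: eq_bigr => i _; rewrite mulr_sumr.
have sumd : \sum_i \sum_j d i j = (\sum_i mu i * (f i * g i)) ^+ 2.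
  by rewrite expr2 mulr_suml; apply: eq_bigr => i _; rewrite mulr_sumr.
rewrite -sumd -sumc.
transitivity (\sum_i \sum_j c i j + \sum_i \sum_j c j i
              - 2 * \sum_i \sum_j d i j).
  rewrite mulr_sumr -big_split -sumrB; apply: eq_bigr => i _ /=.
  by rewrite mulr_sumr -big_split -sumrB.
by rewrite [X in _ + X - _]exchange_big /=; ring.
Qed.

(** * Collisions and energy of Sidon sets *)

(** The equality of differences x - y = z - v is written additively, since subtraction on [nat]
    truncates. *)
Definition nat_sidon (N : nat) (A : {set 'I_N}) : Prop :=
  forall x y z v, x \in A -> y \in A -> z \in A -> v \in A ->
    x != y -> (x + v = z + y)%N -> x = z /\ y = v.

(** For [i = j] only diagonal pairs collide. For [i != j] all colliding pairs share the nonzero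
    difference [j - i], so the Sidon property leaves at most one. *)
Lemma sidon_collisions (N : nat) (A : {set 'I_N}) (i j : nat) : nat_sidon A ->
  (\sum_(x in A) \sum_(y in A) (x + i == y + j)%N <= 1 + #|A| * (i == j))%N.
Proof.
move=> sidA; have [<-|neq_ij] := eqVneq i j.
  rewrite muln1 (leq_trans _ (leq_addl _ _)) // -sum1_card leq_sum // => x xA.
  rewrite (bigD1 x) //= eqxx big1 // => y /andP[_ /negPf yx].
  by rewrite eqn_add2r eq_sym (inj_eq val_inj) yx.
rewrite muln0 addn0 pair_big /=.
have [[x y] /= /and3P[xA yA /eqP xy]|none] :=
  pickP [pred u : 'I_N * 'I_N | [&& u.1 \in A, u.2 \in A & (u.1 + i == u.2 + j)%N]].
  rewrite (bigD1 (x, y)) ?xA ?yA //= xy eqxx big1 // => -[z v] /=.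
  move=> /andP[/andP[zA vA] /negP neq]; case: eqP => // zv.
  case: neq; apply/eqP; have xy' : x != y.
    by apply: contraNN neq_ij => /eqP exy; rewrite exy in xy; lia.
  by have [|-> ->] := sidA x y z v xA yA zA vA xy' => //; lia.
rewrite big1 // => u /andP[u1 u2].
by have := none u; rewrite /= u1 u2 /= => ->.
Qed.

(** Expanding the square and summing over [t] counts collisions x + e i = y + e j with weight
    [phi i * phi j]. In the collision bound, the 1 contributes the squared total mass of [phi], and
    the diagonal term contributes the energy of [phi]. *)
Lemma sidon_energy (R : realFieldType) (N T : nat) (A : {set 'I_N})
    (I : finType) (e : I -> nat) (phi : I -> R) :
  nat_sidon A -> injective e -> (forall i, N + e i <= T)%N ->
  (forall i, 0 <= phi i) -> \sum_i phi i = 1 ->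
  \sum_(t < T) (\sum_(x in A) \sum_i phi i * ((x + e i)%N == t)%:R) ^+ 2
    <= 1 + #|A|%:R * \sum_i phi i ^+ 2.
Proof.
move=> sidA inje leT phi_ge0 phi1.
have -> : \sum_(t < T) (\sum_(x in A) \sum_i phi i * ((x + e i)%N == t)%:R) ^+ 2 =
    \sum_i \sum_j phi i * phi j *
      (\sum_(x in A) \sum_(y in A) (x + e i == y + e j))%N%:R.
  transitivity (\sum_(t < T) \sum_i \sum_j \sum_(x in A) \sum_(y in A)
      phi i * phi j * (((x + e i)%N == t)%:R * ((y + e j)%N == t)%:R)).
    apply: eq_bigr => t _; rewrite exchange_big expr2 mulr_suml.
    apply: eq_bigr => i _; rewrite mulr_sumr; apply: eq_bigr => j _.
    rewrite mulr_suml; apply: eq_bigr => x _.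
    by rewrite mulr_sumr; apply: eq_bigr => y _; rewrite mulrACA.
  rewrite exchange_big; apply: eq_bigr => i _.
  rewrite exchange_big; apply: eq_bigr => j _.
  rewrite exchange_big natr_sum mulr_sumr; apply: eq_bigr => x _.
  rewrite exchange_big natr_sum mulr_sumr; apply: eq_bigr => y _.
  rewrite -mulr_sumr; congr (_ * _).
  have xT : (x + e i < T)%N by have := leT i; have := ltn_ord x; lia.
  rewrite (bigD1 (Ordinal xT)) //= eqxx mul1r big1 ?addr0 1?eq_sym // => t neq.
  case: eqP => [ext|]; last by rewrite mul0r.
  by case/eqP: neq; apply: val_inj.
apply: (@le_trans _ _
  (\sum_i \sum_j phi i * phi j * (1 + #|A|%:R * (i == j)%:R))).
  apply: ler_sum => i _; apply: ler_sum => j _.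
  rewrite ler_wpM2l ?mulr_ge0 // -natrM -(natrD _ 1%N) ler_nat.
  by rewrite -(inj_eq inje); apply: sidon_collisions.
rewrite le_eqVlt; apply/orP; left; apply/eqP.
transitivity (\sum_i (phi i + #|A|%:R * phi i ^+ 2)).
  apply: eq_bigr => i _.
  transitivity (\sum_j (phi i * phi j)
      + \sum_j (phi i * phi j * (#|A|%:R * (i == j)%:R))).
    by rewrite -big_split; apply: eq_bigr => j _; rewrite mulrDr mulr1.
  rewrite -mulr_sumr phi1 mulr1 (bigD1 i) //= eqxx big1 ?addr0.
    by rewrite mulr1; ring.
  by move=> j /negPf ji; rewrite eq_sym ji !mulr0.
by rewrite big_split /= phi1 -mulr_sumr.
Qed.

(** * Blocks, window offsets and boundary weights *)

Lemma boundary_entry_ord (R : realType) (n : nat) (w : 'rV[R]_n) (j : 'I_n) :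
  boundary_entry w j = w 0 j.
Proof. by rewrite /boundary_entry valK. Qed.

Lemma boundary_entry_out (R : realType) (n : nat) (w : 'rV[R]_n) (j : nat) :
  (n <= j)%N -> boundary_entry w j = 1.
Proof. by move=> nj; rewrite /boundary_entry insubN // -leqNgt. Qed.

Definition offset (m h : nat) (u : 'I_m * 'I_h) : nat := (u.1 * h + u.2)%N.

Lemma offset_inj (m h : nat) : injective (@offset m h).
Proof.
move=> [j s] [j' s']; rewrite /offset /= => E.
have h_gt0 : (0 < h)%N by apply: leq_ltn_trans (ltn_ord s).
have := congr1 (divn^~ h) E; have := congr1 (modn^~ h) E => /=.
rewrite !modnMDl !divnMDl // !modn_small // !divn_small // !addn0.
by move=> /val_inj -> /val_inj ->.
Qed.

Lemma offset_lt (m h : nat) (u : 'I_m * 'I_h) : (offset u < m * h)%N.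
Proof.
case: u => j s; rewrite /offset /=.
by rewrite (@leq_trans (j.+1 * h)) ?leq_mul2r ?ltn_ord ?orbT // mulSn addnC ltn_add2r.
Qed.

(** Reversing block and position reflects the window; with the symmetry of [p] this exchanges the
    two ends of the interval. *)
Lemma offset_rev (m h : nat) (u : 'I_m * 'I_h) :
  offset (rev_ord u.1, rev_ord u.2) = (m * h - (offset u).+1)%N.
Proof.
case: u => j s; rewrite /offset /=; have := ltn_ord j; have := ltn_ord s.
move=> sh jm; rewrite mulnBl mulSn.
have : (j.+1 * h <= m * h)%N by rewrite leq_mul2r jm orbT.
by rewrite mulSn; lia.
Qed.

Lemma sum_pair_fst (R : realFieldType) (I J : finType) (f : I -> R) :
  \sum_(u : I * J) f u.1 = #|J|%:R * \sum_i f i.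
Proof.
rewrite -(pair_bigA _ (fun i (_ : J) => f i)) /= mulr_sumr.
by apply: eq_bigr => i _; rewrite sumr_const mulr_natl.
Qed.

Lemma sum_block (R : realFieldType) (h n : nat) (f : nat -> R) : (0 < h)%N ->
  \sum_(0 <= t < n * h) f (t %/ h)%N = h%:R * \sum_(j < n) f j.
Proof.
move=> h_gt0; elim: n => [|n IHn]; first by rewrite mul0n big_geq // big_ord0 mulr0.
rewrite mulSn addnC (@big_cat_nat _ _ _ (n * h)%N) ?leq_addr //= IHn.
rewrite big_ord_recr mulrDr /=; congr (_ + _).
rewrite -{1}[(n * h)%N]add0n big_addn addKn big_mkord.
rewrite (eq_bigr (fun=> f n)) => [|s _]; last first.
  by rewrite addnC divnMDl // divn_small // addn0.
by rewrite sumr_const card_ord mulr_natl.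
Qed.

Lemma sum_block_trunc (R : realFieldType) (h n T : nat) (f : nat -> R) :
  (0 < h)%N -> (n * h <= T)%N -> (forall j, (n <= j)%N -> f j = 0) ->
  \sum_(t < T) f (t %/ h)%N = h%:R * \sum_(j < n) f j.
Proof.
move=> h_gt0 nT f0; rewrite -(big_mkord xpredT (fun t => f (t %/ h)%N)).
rewrite (@big_cat_nat _ _ _ (n * h)%N) //= sum_block //.
rewrite [X in _ + X]big_nat_cond [X in _ + X]big1 ?addr0 // => t /andP[/andP[nt _] _].
by rewrite f0 // leq_divRL.
Qed.

(* Adding the two ends instead of switching between them at the middle keeps
   the covering inequality valid even where the ends overlap: 1 + 1 - 1 = 1. *)
Definition two_sided (R : realType) (n : nat) (w : 'rV[R]_n) (h T t : nat) : R :=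
  boundary_entry w (t %/ h) + boundary_entry w ((T - t.+1) %/ h) - 1.

(** Since 2nh <= T, at most one of the two boundary entries differs from 1 at any [t]. The square
    therefore splits into 1 plus one correction [f] per end, and reflection makes the two
    corrections equal in sum. *)
Lemma two_sided_energy (R : realType) (n : nat) (w : 'rV[R]_n) (h T : nat) :
  (0 < h)%N -> (2 * (n * h) <= T)%N ->
  \sum_(t < T) two_sided w h T t ^+ 2
    = T%:R + 2 * h%:R * (\sum_(j < n) w 0 j ^+ 2 - n%:R).
Proof.
move=> h_gt0 nT; pose f j := boundary_entry w j ^+ 2 - 1.
have f0 j : (n <= j)%N -> f j = 0.
  by move=> nj; rewrite /f boundary_entry_out // expr1n subrr.
have ->: \sum_(t < T) two_sided w h T t ^+ 2 =
    \sum_(t < T) (1 + f (t %/ h)%N + f ((T - t.+1) %/ h)%N).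
  apply: eq_bigr => t _; rewrite /two_sided /f.
  have [le_nt|lt_tn] := leqP n (t %/ h).
    by rewrite boundary_entry_out //; ring.
  rewrite [boundary_entry w ((T - t.+1) %/ h)]boundary_entry_out; first by ring.
  by rewrite leq_divRL //; move: lt_tn; rewrite ltn_divLR //; lia.
rewrite big_split big_split /= sumr_const card_ord.
rewrite [X in _ + _ + X](reindex_inj rev_ord_inj) /=.
rewrite [X in _ + _ + X](eq_bigr (fun t : 'I_T => f (t %/ h)%N)); last first.
  by move=> t _; have := ltn_ord t => tT; congr (f (_ %/ h)%N); lia.
rewrite (@sum_block_trunc _ h n) //; last by lia.
have -> : \sum_(j < n) f j = \sum_(j < n) w 0 j ^+ 2 - n%:R.
  rewrite sumrB sumr_const card_ord; congr (_ - _).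
  by apply: eq_bigr => j _; rewrite boundary_entry_ord.
ring.
Qed.

(** * Covering inequalities at the scale of single integers *)

Section Covering.
Variables (R : realType) (m L K : nat) (lam : 'I_K -> R).
Variables (p : 'I_K -> 'rV[R]_m) (w : 'I_K -> 'rV[R]_(L * m)).
Hypothesis lam_sum : \sum_(r < K) lam r = 1.
Hypothesis p_kernel : forall r, kernel_vector (p r).
Hypothesis cov : covering lam p w.

(** Beyond [L * m] every boundary entry is 1, so the sum is just the total mass of the mixed
    kernels. *)
Lemma covering_all (q : nat) :
  1 <= \sum_(r < K) (lam r * \sum_(i < m) p r 0 i * boundary_entry (w r) (q + i)).
Proof.
have [/cov//|/ltnW lt_q] := leqP q (L * m).
rewrite -lam_sum ler_sum // => r _; have [_ p1 _] := p_kernel r.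
rewrite -[leLHS]mulr1 -p1 le_eqVlt; apply/orP; left; apply/eqP; congr (_ * _).
by apply: eq_bigr => i _; rewrite boundary_entry_out ?mulr1 // (leq_trans lt_q) ?leq_addr.
Qed.

(** Each kernel mass is spread evenly over the [h] positions of its block: total mass stays 1 and
    the energy drops by a factor [h]. *)
Definition step_kernel (h : nat) (r : 'I_K) (u : 'I_m * 'I_h) : R :=
  p r 0 u.1 / h%:R.

Lemma step_kernel_ge0 (h : nat) (r : 'I_K) (u : 'I_m * 'I_h) :
  0 <= step_kernel r u.
Proof. by have [p_ge0 _ _] := p_kernel r; rewrite divr_ge0. Qed.

Lemma step_kernel_sum (h : nat) (r : 'I_K) : (0 < h)%N ->
  \sum_(u : 'I_m * 'I_h) step_kernel r u = 1.
Proof.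
move=> h_gt0; have [_ p1 _] := p_kernel r.
rewrite (sum_pair_fst _ (fun i => p r 0 i / h%:R)) card_ord -mulr_suml p1.
by rewrite mul1r divff // pnatr_eq0 -lt0n.
Qed.

Lemma step_kernel_energy (h : nat) (r : 'I_K) : (0 < h)%N ->
  \sum_(u : 'I_m * 'I_h) step_kernel r u ^+ 2 = (\sum_i p r 0 i ^+ 2) / h%:R.
Proof.
move=> h_gt0; rewrite (sum_pair_fst _ (fun i => (p r 0 i / h%:R) ^+ 2)) card_ord.
have h_neq0 : h%:R != 0 :> R by rewrite pnatr_eq0 -lt0n.
under eq_bigr do rewrite expr_div_n.
by rewrite -mulr_suml; field.
Qed.

(* Fixing the position inside a block turns the sum over cells into an average
   of instances of the finite covering inequality. *)
Lemma covering_cells (h x : nat) : (0 < h)%N ->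
  1 <= \sum_(r < K) lam r * \sum_(u : 'I_m * 'I_h)
         step_kernel r u * boundary_entry (w r) ((x + offset u) %/ h).
Proof.
move=> h_gt0; have h_neq0 : h%:R != 0 :> R by rewrite pnatr_eq0 -lt0n.
pose c q := \sum_(r < K)
  (lam r * \sum_(i < m) p r 0 i * boundary_entry (w r) (q + i)).
have -> : \sum_(r < K) lam r * \sum_(u : 'I_m * 'I_h)
    step_kernel r u * boundary_entry (w r) ((x + offset u) %/ h)
    = \sum_(s < h) h%:R^-1 * c ((x + s) %/ h)%N.
  rewrite -mulr_sumr /c exchange_big mulr_sumr; apply: eq_bigr => r _ /=.
  rewrite -mulr_sumr mulrCA; congr (_ * _).
  rewrite exchange_big mulr_sumr /=.
  rewrite -(pair_bigA _ (fun i s => step_kernel r (i, s) *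
    boundary_entry (w r) ((x + offset (i, s)) %/ h))) /=.
  apply: eq_bigr => i _; rewrite mulr_sumr; apply: eq_bigr => s _.
  rewrite /step_kernel /offset /= addnCA divnMDl // addnC.
  by rewrite [_ / _]mulrC mulrA.
apply: le_trans (_ : \sum_(s < h) h%:R^-1 <= _).
  by rewrite sumr_const card_ord -[_ *+ _]mulr_natr mulVf.
by apply: ler_sum => s _; rewrite ler_peMr ?invr_ge0 ?ler0n // covering_all.
Qed.

Lemma covering_two_sided (h N x : nat) : (0 < h)%N -> (x < N)%N ->
  1 <= \sum_(r < K) lam r * \sum_(u : 'I_m * 'I_h)
         step_kernel r u * two_sided (w r) h (N + m * h) (x + offset u).
Proof.
move=> h_gt0 xN.
have -> : \sum_(r < K) lam r * \sum_(u : 'I_m * 'I_h)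
      step_kernel r u * two_sided (w r) h (N + m * h) (x + offset u)
    = \sum_(r < K) lam r * (\sum_(u : 'I_m * 'I_h)
         step_kernel r u * boundary_entry (w r) ((x + offset u) %/ h))
    + \sum_(r < K) lam r * (\sum_(u : 'I_m * 'I_h)
         step_kernel r u * boundary_entry (w r) ((N - x + offset u) %/ h))
    - \sum_(r < K) lam r.
  rewrite -big_split -sumrB; apply: eq_bigr => r _ /=.
  rewrite -mulrDr -[X in _ - X]mulr1 -mulrBr; congr (_ * _).
  rewrite -(step_kernel_sum r h_gt0).
  (* Reflecting the window turns the right-end term at [x] into a left-end term started at
     [N - x]. *)
  pose rev2 (u : 'I_m * 'I_h) := (rev_ord u.1, rev_ord u.2).
  have rev2K : involutive rev2 by case=> i s; rewrite /rev2 /= !rev_ordK.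
  rewrite [X in _ + X - _](reindex_inj (inv_inj rev2K)) /=.
  rewrite -big_split -sumrB; apply: eq_bigr => u _ /=.
  have -> : step_kernel r (rev2 u) = step_kernel r u.
    by rewrite /step_kernel /=; have [_ _ <-] := p_kernel r.
  rewrite /two_sided offset_rev.
  have -> : (N + m * h - (x + offset u).+1 = N - x + (m * h - (offset u).+1))%N.
    by have := offset_lt u; lia.
  by ring.
rewrite lam_sum; have := covering_cells x h_gt0.
by have := covering_cells (N - x) h_gt0; lra.
Qed.

End Covering.

(** * The quadratic inequality for the size of a Sidon set *)

Lemma sidon_quadratic (R : realType) (m L K : nat) (lam : 'I_K -> R)
    (p : 'I_K -> 'rV[R]_m) (w : 'I_K -> 'rV[R]_(L * m))
    (N h : nat) (A : {set 'I_N}) :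
  (0 < m)%N -> (forall r, 0 <= lam r) -> \sum_(r < K) lam r = 1 ->
  (forall r, kernel_vector (p r)) -> covering lam p w ->
  (0 < h)%N -> (2 * (L * m * h) <= N + m * h)%N -> nat_sidon A ->
  #|A|%:R ^+ 2 <= (N%:R + (m * h)%:R * boundary_energy m L lam w)
                  * (1 + #|A|%:R * (kernel_energy lam p / (m * h)%:R)).
Proof.
move=> m_gt0 lam_ge0 lam_sum p_kernel cov h_gt0 hT sidA.
have h_neq0 : h%:R != 0 :> R by rewrite pnatr_eq0 -lt0n.
have m_neq0 : m%:R != 0 :> R by rewrite pnatr_eq0 -lt0n.
pose T := (N + m * h)%N.
pose W r t := two_sided (w r) h T t.
pose phi := @step_kernel R m K p h.
pose S r t := \sum_(x in A) \sum_u phi r u * ((x + offset u)%N == t)%:R.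
(* After exchanging sums, each point of [A] contributes at least 1 by the covering inequality. *)
have cov_count : #|A|%:R <= \sum_(r < K) lam r * \sum_(t < T) W r t * S r t.
  have -> : \sum_(r < K) lam r * \sum_(t < T) W r t * S r t =
      \sum_(x in A) \sum_(r < K) lam r * \sum_u phi r u * W r (x + offset u)%N.
    rewrite exchange_big; apply: eq_bigr => r _ /=; rewrite -mulr_sumr.
    congr (_ * _); under eq_bigr do rewrite mulr_sumr.
    rewrite exchange_big; apply: eq_bigr => x _ /=.
    under eq_bigr do rewrite mulr_sumr.
    rewrite exchange_big; apply: eq_bigr => u _ /=.
    have xT : (x + offset u < T)%N.
      by have := offset_lt u; have := ltn_ord x; rewrite /T; lia.
    rewrite (bigD1 (Ordinal xT)) //= eqxx mulr1 mulrC big1 ?addr0 // => t neq.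
    case: eqP => [ext|_]; last by rewrite !mulr0.
    by case/eqP: neq; apply: val_inj.
  rewrite -sum1_card natr_sum; apply: ler_sum => x _.
  exact: (covering_two_sided lam_sum p_kernel cov).
have cs : (\sum_(r < K) lam r * \sum_(t < T) W r t * S r t) ^+ 2 <=
    (\sum_(r < K) lam r * \sum_(t < T) W r t ^+ 2)
    * (\sum_(r < K) lam r * \sum_(t < T) S r t ^+ 2).
  (* The double sum becomes a single sum over pairs [(r, t)] with weight [lam r], so Cauchy-Schwarz
     applies once. *)
  have flat (F : 'I_K -> 'I_T -> R) : \sum_r lam r * \sum_t F r t =
      \sum_(i : 'I_K * 'I_T) lam i.1 * F i.1 i.2.
    rewrite -(pair_bigA _ (fun r t => lam r * F r t)).
    by apply: eq_bigr => r _; rewrite mulr_sumr.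
  rewrite !flat.
  exact: (weighted_cauchy_schwarz (fun i : 'I_K * 'I_T => W i.1 i.2)
    (fun i => S i.1 i.2) (fun i => lam_ge0 i.1)).
have sumW : \sum_(r < K) lam r * \sum_(t < T) W r t ^+ 2
    = N%:R + (m * h)%:R * boundary_energy m L lam w.
  under eq_bigr => r _ do
    rewrite two_sided_energy // natrD mulrDr mulrCA mulrBr.
  rewrite big_split /= -mulr_suml lam_sum -mulr_sumr sumrB -mulr_suml lam_sum.
  by rewrite /boundary_energy !natrM; field.
have sumS : \sum_(r < K) lam r * \sum_(t < T) S r t ^+ 2
    <= 1 + #|A|%:R * (kernel_energy lam p / (m * h)%:R).
  apply: (@le_trans _ _
    (\sum_(r < K) lam r * (1 + #|A|%:R * ((\sum_i p r 0 i ^+ 2) / h%:R)))).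
    apply: ler_sum => r _; rewrite ler_wpM2l // -step_kernel_energy //.
    apply: sidon_energy => //; [exact: offset_inj| |exact: step_kernel_ge0|
      exact: step_kernel_sum].
    by move=> u; rewrite leq_add2l ltnW // offset_lt.
  under eq_bigr do rewrite mulrDr mulr1 mulrCA [lam _ * (_ / _)]mulrA.
  rewrite big_split /= lam_sum -mulr_sumr -mulr_suml lerD2l /kernel_energy natrM.
  rewrite le_eqVlt; apply/orP; left; apply/eqP.
  by field; rewrite h_neq0.
have sumW_ge0 : 0 <= \sum_(r < K) lam r * \sum_(t < T) W r t ^+ 2.
  by apply: sumr_ge0 => r _; rewrite mulr_ge0 // sumr_ge0 // => t _; rewrite sqr_ge0.
rewrite -sumW; apply: le_trans (ler_wpM2l sumW_ge0 sumS); apply: le_trans cs.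
by rewrite ler_sqr ?nnegrE ?ler0n // (le_trans _ cov_count) ?ler0n.
Qed.

(** * Passage from integer sets to subsets of ['I_N] *)

Lemma sidon_max_le (R : realType) (N : nat) (X : R) : 0 <= X ->
  (forall A : {set 'I_N}, nat_sidon A -> #|A|%:R <= X) -> (sidon_max N)%:R <= X.
Proof.
move=> X_ge0 bound; rewrite /sidon_max big_seq_cond.
apply: (big_ind (fun n => n%:R <= X)) => [//|x y xX yX|B].
  by rewrite /maxn; case: ifP.
rewrite andbC => /andP[/asboolP sidB]; rewrite fpowersetE => /fsubsetP subB.
pose A := [set x : 'I_N | (x : nat)%:Z \in B]; have sidA : nat_sidon A.
  move=> x y z v; rewrite !inE => xB yB zB vB /eqP neq exy.
  have diff : (x : nat)%:Z - (y : nat)%:Z = (z : nat)%:Z - (v : nat)%:Z by lia.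
  have diff_neq0 : (x : nat)%:Z - (y : nat)%:Z <> 0.
    by move=> exy0; case: neq; apply: val_inj => /=; lia.
  by case: (sidB _ _ _ _ xB yB zB vB diff diff_neq0) => /val_inj -> /val_inj ->.
apply: le_trans (bound A sidA); rewrite ler_nat.
(* [B] is the image of its pullback [A], so its cardinality is at most that of [A]. *)
have -> : B = [fset (nat_of_ord x)%:Z | x in A]%fset.
  apply/fsetP => z; apply/idP/imfsetP => [zB|[x /=]]; last by rewrite inE => xB ->.
  have /imfsetP[n /=] := subB z zB; rewrite mem_iota add0n => /andP[_ nN] zn.
  by exists (Ordinal nN); rewrite ?inE /= -?zn.
by rewrite (leq_trans (leq_imfset_card _ _ _)) // cardE.
Qed.

(** * Choice of the window length and conclusion *)

(** Supplies [a > 0] for the optimization. Each square is bounded below by its tangent line at 1/m,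
    and the tangents sum to 1/m. *)
Lemma kernel_energy_ge1 (R : realType) (m K : nat) (lam : 'I_K -> R)
    (p : 'I_K -> 'rV[R]_m) : (0 < m)%N ->
  (forall r, 0 <= lam r) -> \sum_(r < K) lam r = 1 ->
  (forall r, kernel_vector (p r)) -> 1 <= kernel_energy lam p.
Proof.
move=> m_gt0 lam_ge0 lam_sum p_kernel.
have m_gt0R : 0 < m%:R :> R by rewrite ltr0n.
rewrite /kernel_energy mulrC -ler_pdivrMr // div1r.
have -> : m%:R^-1 = \sum_(r < K) lam r * m%:R^-1 by rewrite -mulr_suml lam_sum mul1r.
apply: ler_sum => r _; rewrite ler_wpM2l //; have [_ p1 _] := p_kernel r.
apply: (@le_trans _ _ (\sum_(i < m) (2 * m%:R^-1 * p r 0 i - m%:R^-1 ^+ 2))).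
  rewrite sumrB -mulr_sumr p1 sumr_const card_ord -[_ ^+ 2 *+ _]mulr_natr le_eqVlt.
  by apply/orP; left; apply/eqP; field; rewrite gt_eqF.
apply: ler_sum => i _; rewrite -subr_ge0.
suff -> : p r 0 i ^+ 2 - (2 * m%:R^-1 * p r 0 i - m%:R^-1 ^+ 2)
  = (p r 0 i - m%:R^-1) ^+ 2 by apply: sqr_ge0.
by ring.
Qed.

(* The window length u = (c / b) s^3 balances the two error terms a s^4 / u
   and u b, both of which become c s^3 after division by the main term. *)
Lemma optimized_window (R : realFieldType) (k s a b c d u : R) :
  0 < a -> 0 < b -> 0 < c -> c ^+ 2 = a * b -> 1 <= s -> 0 <= d ->
  c / b * s ^+ 3 <= u -> u <= c / b * s ^+ 3 + d ->
  k ^+ 2 <= (s ^+ 4 + u * b) * (1 + k * (a / u)) ->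
  k <= s ^+ 2 + c * s + (c ^+ 2 + d * b + 1).
Proof.
move=> a0 b0 c0 cab s1 d0 u_lb u_ub quad; rewrite leNgt; apply/negP => k_gt.
have s0 : 0 < s by lra.
have u0 : 0 < u by apply: lt_le_trans u_lb; rewrite mulr_gt0 ?exprn_gt0 ?divr_gt0.
have db0 : 0 <= d * b by rewrite mulr_ge0 // ltW.
have cs0 : 0 < c * s by rewrite mulr_gt0.
have ss0 : 0 < s ^+ 2 by rewrite exprn_gt0.
have cc0 : 0 <= c ^+ 2 by apply: sqr_ge0.
have k0 : 0 < k by lra.
have ub : u * b <= c * s ^+ 3 + d * b.
  have := ler_wpM2r (ltW b0) u_ub.
  by rewrite mulrDl [c / b * _ * b]mulrAC divfK ?gt_eqF.
(* The part u b (a / u) is exactly c^2; the part a s^4 / u is at most c s by the lower bound on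
   [u]. *)
have slope : (s ^+ 4 + u * b) * (a / u) <= c * s + c ^+ 2.
  have -> : (s ^+ 4 + u * b) * (a / u) = a * s ^+ 4 / u + c ^+ 2.
    by rewrite cab; field; rewrite gt_eqF.
  rewrite lerD2r ler_pdivrMr //.
  have -> : a * s ^+ 4 = c * s * (c / b * s ^+ 3).
    have -> : c * s * (c / b * s ^+ 3) = c ^+ 2 / b * s ^+ 4 by ring.
    by rewrite cab mulfK ?gt_eqF.
  by rewrite ler_wpM2l // ltW.
have kslope := ler_wpM2l (ltW k0) slope.
(* [quad], [slope] and [ub] give k (k - c s - c^2) <= s^4 + c s^3 + d b. The assumed size of [k]
   puts the left side above (s^2 + c s)(s^2 + d b + 1), which [slack] shows to be too large. *)
have gap : (s ^+ 2 + c * s) * (s ^+ 2 + d * b + 1) < k * (k - c * s - c ^+ 2).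
  by apply: ltr_pM; lra.
have slack : 0 <= (s ^+ 2 + c * s - 1) * (d * b + 1).
  have : 1 <= s ^+ 2 by rewrite expr_ge1 // ltW.
  by move=> s2; rewrite mulr_ge0; lra.
move: quad kslope gap slack ub; move: (a / u) (u * b) => v y.
by rewrite !exprS expr0; lra.
Qed.

Theorem theorem2p1 (R : realType) (m L K : nat)
    (m_ge1 : (1 <= m)%N) (L_ge1 : (1 <= L)%N) (K_ge1 : (1 <= K)%N)
    (lam : 'I_K -> R)
    (lam_ge0 : forall r, 0 <= lam r) (lam_sum : \sum_(r < K) lam r = 1)
    (p : 'I_K -> 'rV[R]_m) (w : 'I_K -> 'rV[R]_(L * m))
    (p_kernel : forall r, kernel_vector (p r))
    (cov : covering lam p w)
    (b_gt0 : 0 < boundary_energy m L lam w) :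
  exists (C : R) (N0 : nat), forall N : nat, (N0 <= N)%N ->
    (sidon_max N)%:R <=
      N%:R `^ (1 / 2)
      + Num.sqrt (kernel_energy lam p * boundary_energy m L lam w) * N%:R `^ (1 / 4)
      + C.
Proof.
have a_ge1 := kernel_energy_ge1 m_ge1 lam_ge0 lam_sum p_kernel.
have quadratic := sidon_quadratic m_ge1 lam_ge0 lam_sum p_kernel cov.
move: (kernel_energy lam p) (boundary_energy m L lam w) a_ge1 b_gt0 quadratic.
move=> a b a_ge1 b_gt0 quadratic.
have a_gt0 : 0 < a by lra.
set c := Num.sqrt (a * b).
have c_gt0 : 0 < c by rewrite sqrtr_gt0 mulr_gt0.
have c_sqr : c ^+ 2 = a * b by rewrite sqr_sqrtr // mulr_ge0 ?ltW.
have m_gt0 : 0 < m%:R :> R by rewrite ltr0n.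
have cb_gt0 : 0 < c / b by rewrite divr_gt0.
(* Chosen so that s >= S0 gives 2 L m h <= 2 L (x + m) <= S0 s^3 <= s^4 = N, keeping the two
   boundary layers disjoint. *)
pose S0 := 2 * L%:R * (c / b + m%:R) + 1.
have S0_ge1 : 1 <= S0.
  by rewrite /S0 lerDr !mulr_ge0 ?ler0n // addr_ge0 ?ltW.
(* [C] is the error of [optimized_window] with d = m, the rounding loss of the window length; the
   threshold on [N] forces s >= S0. *)
exists (c ^+ 2 + m%:R * b + 1), (Num.truncn (S0 ^+ 4)).+1 => N le_N0N.
pose s : R := N%:R `^ (1 / 4).
have s_ge0 : 0 <= s by apply: powR_ge0.
have s4 : s ^+ 4 = N%:R.
  by rewrite -powR_mulrn // -powRrM div1r mulVf ?pnatr_eq0 // powRr1 ?ler0n.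
have s2 : s ^+ 2 = N%:R `^ (1 / 2).
  by rewrite -powR_mulrn // -powRrM; congr (_ `^ _); field.
have s_ge : S0 <= s.
  rewrite -(@ler_pXn2r _ 4) ?nnegrE ?(le_trans ler01 S0_ge1) // s4 ltW //.
  by rewrite (lt_le_trans (truncnS_gt _)) // ler_nat.
have s_ge1 : 1 <= s by lra.
pose x := c / b * s ^+ 3.
have x_ge0 : 0 <= x by rewrite mulr_ge0 ?exprn_ge0 // ltW.
(* Rounding up to a multiple of [m] places the window length m h between x and x + m. *)
pose h := (Num.truncn (x / m%:R)).+1.
have u_lb : x <= (m * h)%:R.
  by rewrite natrM -ler_pdivrMl // mulrC ltW // truncnS_gt.
have u_ub : (m * h)%:R <= x + m%:R.
  rewrite natrM -natr1 mulrDr mulr1 lerD2r -ler_pdivlMl // mulrC.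
  by rewrite truncn_le mulr_ge0 ?invr_ge0 // ltW.
have hT : (2 * (L * m * h) <= N + m * h)%N.
  apply: (@leq_trans N); rewrite ?leq_addr // -(ler_nat R) -s4 -mulnA !natrM -natrM.
  have s3 : 1 <= s ^+ 3 by rewrite expr_ge1.
  apply: (@le_trans _ _ (S0 * s ^+ 3)); last by rewrite [s ^+ 4]exprS ler_wpM2r ?exprn_ge0.
  apply: (@le_trans _ _ (2 * L%:R * (c / b + m%:R) * s ^+ 3)).
    rewrite mulrA -[leRHS]mulrA ler_wpM2l ?mulr_ge0 ?ler0n // (le_trans u_ub) //.
    by rewrite mulrDl lerD2l ler_peMr // ltW.
  by rewrite ler_wpM2r ?exprn_ge0 // lerDl.
rewrite -/s -s2; apply: sidon_max_le => [|A sidA].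
  have := mulr_ge0 (ltW c_gt0) s_ge0; have := mulr_ge0 (ltW m_gt0) (ltW b_gt0).
  by have := sqr_ge0 s; have := sqr_ge0 c; lra.
have := quadratic N h A erefl hT sidA; rewrite -s4.
exact: (optimized_window a_gt0 b_gt0 c_gt0 c_sqr s_ge1 (ltW m_gt0) u_lb u_ub).
Qed.
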